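(* Let $n$ be a positive integer, $0\le m\le\lfloor n/2\rfloor$ and $0\le k\le m$. Let $M^{(n-m,m)}$ be the complex vector space with basis $\{e_\sigma\}$ indexed by the $m$-element subsets $\sigma$ of $\{1,\dots,n\}$, let $b_0,\dots,b_m$ be complex numbers and let $B=B_{(n-m,m)}$ be the matrix (in the basis $\{e_\sigma\}$) whose $(\sigma,\tau)$ entry is $b_{\#(\sigma\cap\tau)}$. Let $\Omega=\{n-m+1,\dots,n\}$ and define the linear map $\pi:\mathbb{C}[S_n]\to M^{(n-m,m)}$ by $\pi(g)=e_{g(\Omega)}$ for $g\in S_n$. Let $T_k$ be the Young tableau of shape $(n-k,k)$ whose first row contains $1,\dots,n-k$ and whose second row contains $n-k+1,\dots,n$, with row subgroup $R(T_k)$ and column subgroup $C(T_k)$, and let $c_k=\big(\sum_{q\in C(T_k)}\operatorname{sgn}(q)q\big)\big(\sum_{p\in R(T_k)}p\big)\in\mathbb{C}[S_n]$. Then $\pi(c_k)$ is an eigenvector of $B$ with eigenvalue $$\lambda_k=\sum_{j=0}^{k}\sum_{p=0}^{m-k}(-1)^{k-j}\binom{k}{j}\binom{m-j}{p}\binom{n-m-k+j}{m-k-p}\,b_{j+p},$$ and, for generic $b_0,\dots,b_m$, the multiplicity of $\lambda_k$ as an eigenvalue of $B$ is $$f^{(n-k,k)}=\frac{n!\,(n-2k+1)}{k!\,(n-k+1)!}.$$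
   Context: $\#X$ denotes the cardinality of a finite set $X$. The row subgroup $R(T_k)$ (resp. column subgroup $C(T_k)$) consists of the permutations of $\{1,\dots,n\}$ preserving each row (resp. each column) of $T_k$ as a set. Products in the group ring are composition of permutations, $qp=q\circ p$. *)

(* Defs.v *)
From mathcomp Require Import all_boot all_algebra all_fingroup.
From mathcomp Require Import Rstruct.
From mathcomp Require Import complex.
From mathcomp Require Export mpoly.


Import GRing.Theory.
Local Open Scope ring_scope.

Definition C : fieldType := (Rdefinitions.R)[i].

(* Convention: {1,...,n} is represented by 'I_n = {0,...,n-1} (i |-> i-1). *)

Definition msub (n m : nat) := {s : {set 'I_n} | #|s| == m}.

(* An element of M^{(n-m,m)} is given by its coordinates in the basis e_sigma. *)
Definition Mvec (n m : nat) := {ffun msub n m -> C}.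

Definition Omega (n m : nat) : {set 'I_n} := [set i : 'I_n | (n - m <= i)%N].

Definition grpring (n : nat) := {ffun {perm 'I_n} -> C}.

(* Product in the group ring, with q p = q \o p.  In MathComp
   (p * q)%g x = q (p x), so q \o p is the perm (p * q)%g. *)
Definition grmul (n : nat) (x y : grpring n) : grpring n :=
  [ffun g => \sum_(q : {perm 'I_n}) \sum_(p : {perm 'I_n} | (p * q)%g == g)
               x q * y p].

Definition piM (n m : nat) (x : grpring n) : Mvec n m :=
  [ffun s => \sum_(g : {perm 'I_n}) x g * ((g @: Omega n m) == val s)%:R].

(* Tableau T_k of shape (n-k,k): first row {1..n-k}, second row {n-k+1..n}.
   0-based: row 1 = {0..n-k-1}, row 2 = {n-k..n-1}. *)
Definition rowT (n k : nat) (i : 'I_n) : bool := (n - k <= i)%N.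
(* Columns of T_k: column j contains the j-th entries of each row, i.e.
   0-based column j < k is {j, n-k+j}, column j in [k, n-k) is {j}. *)
Definition colT (n k : nat) (i : 'I_n) : nat :=
  if (i < n - k)%N then nat_of_ord i else (i - (n - k))%N.

Definition rowgrp (n k : nat) : {set {perm 'I_n}} :=
  [set p : {perm 'I_n} | [forall i : 'I_n, rowT n k (p i) == rowT n k i]].
Definition colgrp (n k : nat) : {set {perm 'I_n}} :=
  [set q : {perm 'I_n} | [forall i : 'I_n, colT n k (q i) == colT n k i]].

Definition colsym (n k : nat) : grpring n :=
  [ffun q => if q \in colgrp n k then (-1) ^+ odd_perm q else 0].
Definition rowsym (n k : nat) : grpring n :=
  [ffun p => (p \in rowgrp n k)%:R].

Definition youngc (n k : nat) : grpring n := grmul n (colsym n k) (rowsym n k).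

Definition Bmat (n m : nat) (b : 'I_m.+1 -> C) : 'M[C]_#|{: msub n m}| :=
  \matrix_(i, j) b (inord #|val (enum_val i) :&: val (enum_val j)|).

Definition colvec (n m : nat) (v : Mvec n m) : 'cV[C]_#|{: msub n m}| :=
  \col_i v (enum_val i).

Definition lambdak (n m k : nat) (b : 'I_m.+1 -> C) : C :=
  \sum_(j < k.+1) \sum_(p < (m - k).+1)
     (-1) ^+ (k - j) * ('C(k, j))%:R * ('C(m - j, p))%:R
       * ('C(n - m - k + j, m - k - p))%:R * b (inord (j + p)).

Definition fdim (n k : nat) : nat :=
  (n`! * (n - 2 * k + 1) %/ (k`! * (n - k + 1)`!))%N.

(* Main.v *)
Require Import Defs.
From mathcomp Require Import all_boot all_algebra all_fingroup.
From mathcomp Require Import mpoly.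
From mathcomp Require Import Rstruct complex zify.
Import GRing.Theory.
Local Open Scope ring_scope.

(** Let [W_(i,k)] be the inclusion matrix of [i]-subsets versus [k]-subsets.
    Newton's forward difference formula writes every matrix whose entries
    depend only on the size of an intersection as a combination of the
    [W_(i,k)^T W_(i,l)].

    Up to a nonzero integer, [pi (c_k)] is [W_(k,m)^T u] where [u] is the signed
    sum of the column translates of the second row, and [W_(i,k) u = 0] for
    [i < k].  The entries of [W_(k,m) B] depend only on the size of the
    intersection, through a function [f] that counts supersets, so
    [B W_(k,m)^T u] is [W_(k,m)^T u] times the [k]-th forward difference of [f]
    at 0, which is [lambda_k].

    For the multiplicities, [sum_(i <= l+1) c_i W_(i,l+1)^T W_(i,l+1)] has the
    form [c_(l+1) + Z V] with [V = W_(l,l+1)], and [c_(l+1) + V Z] is again such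
    a combination at level [l].  Since [det (t - Z V)] and [det (t - V Z)] agree
    up to a power of [t], the characteristic polynomial acquires exactly
    [binom(n,l+1) - binom(n,l)] factors [X - c_(l+1)] at each level.  The
    resulting eigenvalues are identified with the [lambda_k] through the
    eigenvectors [W_(k,m)^T u], and for [j < k] the choice [b_s = binom(s,j)]
    separates [lambda_j] from [lambda_k]. *)

(** * Determinants of matrix products taken in the two orders *)

(** Column operations reduce the block matrix with rows (t, V) and (Z, 1) in two ways: one clears Z,
    the other clears V at the cost of a factor t^N. Nothing is inverted, so t may be a
    polynomial. *)
Lemma det_scalar_sub_mulmxC {R : comPzRingType} {N r : nat} (t : R)
    (Z : 'M[R]_(N, r)) (V : 'M[R]_(r, N)) :
  t ^+ r * \det (t%:M - Z *m V) = t ^+ N * \det (t%:M - V *m Z).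
Proof.
pose D := block_mx t%:M V Z (1%:M : 'M[R]_N).
have E1 : \det D = \det (t%:M - V *m Z).
  have -> : \det D = \det (D *m block_mx 1%:M 0 (- Z) 1%:M).
    by rewrite det_mulmx det_lblock !det1 !mulr1.
  rewrite mulmx_block !mulmx1 !mulmx0 !mul1mx !mulmxN addrN !add0r.
  by rewrite det_ublock det1 mulr1.
have E2 : \det D * t ^+ N = t ^+ r * \det (t%:M - Z *m V).
  have -> : t ^+ N = \det (block_mx 1%:M (- V) 0 (t%:M : 'M_N)).
    by rewrite det_ublock det1 mul1r det_scalar.
  rewrite -det_mulmx mulmx_block !mulmx1 !mulmx0 !mul1mx !mulmxN !addr0.
  rewrite mul_scalar_mx mul_mx_scalar addNr det_lblock det_scalar.
  by rewrite [- _ + _]addrC.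
by rewrite -E2 E1 mulrC.
Qed.

(** This is the determinant identity over F[X] at t = X - a; the common factor (X - a)^r cancels
    because F[X] is a domain. *)
Lemma char_poly_scalar_add_mulmxC {F : fieldType} {N r : nat} (a : F)
    (Z : 'M[F]_(N, r)) (V : 'M[F]_(r, N)) : (r <= N)%N ->
  char_poly (a%:M + Z *m V) =
    ('X - a%:P) ^+ (N - r) * char_poly (a%:M + V *m Z).
Proof.
move=> rN.
have E M (U : 'M[F]_M) :
    char_poly_mx (a%:M + U) = ('X - a%:P)%:M - map_mx polyC U.
  by rewrite /char_poly_mx map_mxD map_scalar_mx opprD addrA raddfB.
have nz : ('X - a%:P) ^+ r != 0 by rewrite expf_neq0 ?polyXsubC_eq0.
apply: (mulfI nz).
rewrite mulrA -exprD subnKC // /char_poly !E !map_mxM.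
exact: det_scalar_sub_mulmxC.
Qed.

(** * Forward differences *)

(* The [i]-th forward difference of [g] at 0. *)
Definition newton {R : pzRingType} (g : nat -> R) (i : nat) : R :=
  \sum_(j < i.+1) (-1) ^+ (i - j) * ('C(i, j))%:R * g j.

(** Binomial inversion: [H] compares the coefficients of X^j in X^s = sum_i binom(s,i) (X-1)^i. The
    sum may run up to any k >= s, since binom(s,i) vanishes for i > s. *)
Lemma newton_forward {R : comNzRingType} (g : nat -> R) (k s : nat) : (s <= k)%N ->
  g s = \sum_(i < k.+1) newton g i * ('C(s, i))%:R.
Proof.
move=> sk.
have H j : (j < k.+1)%N ->
    \sum_(i < k.+1) (if (j <= i)%N then (-1) ^+ (i - j) * ('C(i, j))%:R else 0)
      * ('C(s, i))%:R = (j == s)%:R :> R.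
  move=> jk; rewrite -(coefXn R s j).
  have -> : 'X^s = \sum_(i < k.+1) ('X - 1%:P) ^+ i *+ 'C(s, i) :> {poly R}.
    rewrite -{1}(subrKC (1%:P : {poly R}) 'X) exprDn (big_ord_widen k.+1
      (fun i => 1%:P ^+ (s - i) * ('X - 1%:P) ^+ i *+ 'C(s, i) : {poly R})) //.
    rewrite big_mkcond; apply: eq_bigr => i _ /=; rewrite polyC1 expr1n mul1r.
    by case: leqP => // si; rewrite bin_small.
  rewrite coef_sum; apply: eq_bigr => i _; rewrite coefMn mulr_natr; congr (_ *+ _).
  rewrite exprBn coef_sum; case: leqP => [ji | ij]; last first.
    apply/esym/big1 => p _; rewrite -polyC_exp -polyCN -polyC_exp.
    rewrite mulrAC -polyCM coefMn coefCM coefXn.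
    by rewrite gtn_eqF ?mulr0 ?mul0rn //; apply: leq_ltn_trans ij; rewrite leq_subr.
  rewrite (bigD1 (Ordinal (leq_ltn_trans (leq_subr j i) (ltnSn i)))) //= big1 => [|p].
    rewrite -polyC_exp -polyCN -polyC_exp mulrAC -polyCM coefMn coefCM coefXn.
    by rewrite subKn // eqxx mulr1 expr1n mulr1 addr0 bin_sub // mulr_natr.
  rewrite -val_eqE /= => pj.
  rewrite -polyC_exp -polyCN -polyC_exp mulrAC -polyCM coefMn coefCM coefXn.
  rewrite (_ : (j == i - p)%N = false) ?mulr0 ?mul0rn //.
  by apply/negbTE; move: pj; apply: contraNneq => ->; rewrite subKn // -ltnS.
transitivity (\sum_(j < k.+1) (val j == s)%:R * g j).
  rewrite (bigD1 (Ordinal (sk : (s < k.+1)%N))) //= eqxx mul1r big1 ?addr0 // => j.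
  by rewrite -val_eqE /= => /negbTE->; rewrite mul0r.
under eq_bigr => j _ do rewrite -(H j (ltn_ord j)) mulr_suml.
rewrite exchange_big; apply: eq_bigr => i _ /=.
rewrite /newton (big_ord_widen k.+1
  (fun j => (-1) ^+ (i - j) * ('C(i, j))%:R * g j)) // mulr_suml.
rewrite [RHS]big_mkcond; apply: eq_bigr => j _ /=; rewrite ltnS.
by case: leqP => _; rewrite ?mul0r // mulrAC.
Qed.

Lemma natrC_eq0 (a : nat) : (a%:R == 0 :> C) = (a == 0%N).
Proof. exact: (@Num.Theory.pnatr_eq0 (Rdefinitions.R)[i]). Qed.

(** * Counting subsets *)

Lemma card_between {T : finType} (I S : {set T}) (k : nat) :
  I \subset S -> (#|I| <= k)%N ->
  #|[set A : {set T} | [&& I \subset A, A \subset S & #|A| == k]]|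
    = 'C(#|S| - #|I|, k - #|I|).
Proof.
move=> IS Ik; rewrite -(cardsDS IS) -cards_draws.
rewrite -[RHS](@card_in_imset _ _ (setU I)) => [|A B]; last first.
  rewrite !inE !subsetD => /andP[/andP[_ AI] _] /andP[/andP[_ BI] _] E.
  have := congr1 (fun X => X :\: I) E.
  by rewrite !setDUl setDv !set0U !(setDidPl _).
apply: eq_card => A; rewrite inE; apply/idP/imsetP => [/and3P[IA AS /eqP Ak]|[B]].
  exists (A :\: I); last by rewrite -{1}(setIidPr IA) setID.
  by rewrite inE setSD //= cardsDS // Ak.
rewrite inE subsetD => /andP[/andP[BS BI] /eqP Bk] ->.
rewrite subsetUl subUset IS BS /=.
by rewrite cardsU disjoint_setI0 1?disjoint_sym // cards0 subn0 Bk subnKC.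
Qed.

(** Such an A is uniquely K together with p points of S outside K and q points outside both S and
    K. *)
Lemma card_superset_meet {T : finType} (K S : {set T}) (p q : nat) :
  #|[set A : {set T} | [&& K \subset A, #|A| == (#|K| + p + q)%N
                        & #|A :&: S| == (#|K :&: S| + p)%N]]|
    = ('C(#|S :\: K|, p) * 'C(#|~: (S :|: K)|, q))%N.
Proof.
rewrite -!cards_draws -cardsX.
pose f (X : {set T} * {set T}) := K :|: (X.1 :|: X.2).
have dK X Y : (X, Y) \in setX [set A : {set T} | A \subset S :\: K & #|A| == p]
    [set A : {set T} | A \subset ~: (S :|: K) & #|A| == q] ->
    [/\ (f (X, Y) :\: K) :&: S = X, (f (X, Y) :\: K) :\: S = Y,
        #|f (X, Y)| = (#|K| + p + q)%N & #|f (X, Y) :&: S| = (#|K :&: S| + p)%N].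
  rewrite !inE => /andP[/andP[/subsetP XS /eqP Xp] /andP[/subsetP YS /eqP Yq]].
  have XE x : (x \in X) -> (x \in S) /\ (x \notin K).
    by move/XS; rewrite inE => /andP[].
  have YE x : (x \in Y) -> (x \notin S) /\ (x \notin K).
    by move/YS; rewrite !inE negb_or => /andP[].
  split.
  - apply/setP=> x; move: (XE x) (YE x); rewrite /f !inE /=.
    by case: (x \in X) (x \in Y) (x \in S) (x \in K)
      => [] [] [] [] //= h1 h2; case: h1 => //; case: h2.
  - apply/setP=> x; move: (XE x) (YE x); rewrite /f !inE /=.
    by case: (x \in X) (x \in Y) (x \in S) (x \in K)
      => [] [] [] [] //= h1 h2; case: h1 => //; case: h2.
  - rewrite /f /= cardsU cardsU.
    have -> : X :&: Y = set0.
      by apply/setP=> x; rewrite !inE; apply/negP => /andP[/XE[xS _] /YE[]]; rewrite xS.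
    have -> : K :&: (X :|: Y) = set0.
      apply/setP=> x; rewrite !inE; apply/negP => /andP[xK /orP[/XE[]|/YE[]]];
      by rewrite xK.
    by rewrite Xp Yq cards0 !subn0 addnA.
  - have -> : f (X, Y) :&: S = (K :&: S) :|: X.
      apply/setP=> x; move: (XE x) (YE x); rewrite /f !inE /=.
      by case: (x \in X) (x \in Y) (x \in S) (x \in K)
        => [] [] [] [] //= h1 h2; case: h1 => //; case: h2.
    rewrite cardsU Xp (_ : _ :&: X = set0) ?cards0 ?subn0 //.
    by apply/setP=> x; rewrite !inE; apply/negP => /andP[/andP[xK _] /XE[]]; rewrite xK.
rewrite -[RHS](@card_in_imset _ _ f) => [|[X Y] [X' Y'] hX hX' E]; last first.
  by case: (dK _ _ hX) (dK _ _ hX') => [E1 E2 _ _] [E1' E2' _ _]; 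
  congr (_, _); [rewrite -E1 E E1' | rewrite -E2 E E2'].
apply: eq_card => A; rewrite inE; apply/idP/imsetP => [|[[X Y] h ->]]; last first.
  by case: (dK _ _ h) => _ _ -> ->; rewrite !eqxx subsetUl.
case/and3P=> KA /eqP Ac /eqP AS.
exists ((A :\: K) :&: S, (A :\: K) :\: S); last first.
  by rewrite /f /= setID -{1}(setIidPr KA) setID.
have c1 : #|(A :\: K) :&: S| = p.
  have -> : (A :\: K) :&: S = (A :&: S) :\: (K :&: S).
    by apply/setP=> x; rewrite !inE; case: (x \in A) (x \in K) (x \in S) => [] [] [].
  by rewrite cardsDS ?setSI // AS addKn.
rewrite !inE c1 eqxx /=; apply/and3P; split.
- by apply/andP; split=> //; apply/subsetP=> x; rewrite !inE => /andP[/andP[-> _] ->].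
- by apply/subsetP=> x; rewrite !inE => /and3P[/negbTE-> /negbTE->].
- have := cardsID S (A :\: K); rewrite c1 (cardsDS KA) Ac => E.
  by apply/eqP; lia.
Qed.

(** * Inclusion matrices *)

Lemma sum_msub {V : nmodType} (n k : nat) (F : {set 'I_n} -> V) :
  \sum_(i < #|{: msub n k}|) F (val (enum_val i)) = \sum_(A : {set 'I_n} | #|A| == k) F A.
Proof.
rewrite -(big_enum_val (fun x : msub n k => F (val x))) /=.
exact: esym (big_sub (fun A : {set 'I_n} => #|A| == k) F).
Qed.

Lemma card_msub_enum (n k : nat) (i : 'I_#|{: msub n k}|) : #|val (enum_val i)| = k.
Proof. exact/eqP/(valP (enum_val i)). Qed.

Lemma card_msub (n k : nat) : #|{: msub n k}| = 'C(n, k).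
Proof. by rewrite card_sig -[RHS](congr1 (binomial^~ k) (card_ord n)) -card_draws cardsE. Qed.

Lemma sum_natr_bool {T : finType} {R : pzSemiRingType} (P Q : pred T) :
  \sum_(x | P x) (Q x)%:R = #|[set x | P x & Q x]|%:R :> R.
Proof.
rewrite -sum1_card natr_sum; under [RHS]eq_bigl => x do rewrite inE.
by rewrite big_mkcondr; apply: eq_bigr => x _; case: (Q x).
Qed.

Definition inclmx (n i k : nat) : 'M[C]_(#|{: msub n i}|, #|{: msub n k}|) :=
  \matrix_(a < #|{: msub n i}|, b < #|{: msub n k}|)
    (val (enum_val a) \subset val (enum_val b))%:R.

Lemma inclmx_trmul (n i k l : nat) a b :
  ((inclmx n i k)^T *m inclmx n i l) a b
    = ('C(#|val (enum_val a) :&: val (enum_val b)|, i))%:R.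
Proof.
rewrite mxE; set A := val _; set B := val _.
under eq_bigr => c _ do rewrite !mxE -natrM mulnb -subsetI.
rewrite (sum_msub n i (fun I => (I \subset A :&: B)%:R)) sum_natr_bool -cards_draws.
by congr (_%:R); apply: eq_card => I; rewrite !inE andbC.
Qed.

Lemma inclmx_id (n k : nat) : inclmx n k k = 1%:M.
Proof.
apply/matrixP => a b; rewrite !mxE; congr (_%:R).
by rewrite -(inj_eq enum_val_inj) -(inj_eq val_inj) eqEcard !card_msub_enum leqnn andbT.
Qed.

Lemma inclmx_mul (n i k l : nat) : (i <= k)%N -> (k <= l)%N ->
  inclmx n i k *m inclmx n k l = ('C(l - i, k - i))%:R *: inclmx n i l.
Proof.
move=> ik kl; apply/matrixP => a b; rewrite !mxE; set A := val _; set B := val _.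
have Ai : #|A| = i by exact: card_msub_enum.
have Bl : #|B| = l by exact: card_msub_enum.
under eq_bigr => c _ do rewrite !mxE -natrM mulnb.
rewrite (sum_msub n k (fun I => ((A \subset I) && (I \subset B))%:R)) sum_natr_bool.
have [AB|nAB] := boolP (A \subset B).
  rewrite mulr1 -Ai -Bl -card_between ?Ai //.
  by congr (_%:R); apply: eq_card => I; rewrite !inE andbC andbA.
rewrite mulr0 (_ : [set x | _ & _] = set0) ?cards0 //.
apply/setP => I; rewrite !inE; apply/negP => /and3P[_ AI IB].
by case/negP: nAB; apply: subset_trans IB.
Qed.

(** The entry at (R, I) on the left counts the (l+1)-sets containing the union of R and I, whose
    size is l + i - s with s the size of R meet I. *)
Lemma inclmx_up_down (n l i : nat) : (i <= l)%N -> (l + i <= n)%N ->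
  inclmx n l l.+1 *m (inclmx n i l.+1)^T
    = (n - l - i)%:R *: (inclmx n i l)^T
      + (if i is i'.+1 then (inclmx n i' l)^T *m inclmx n i' i else 0).
Proof.
move=> il lin; apply/matrixP => a b; rewrite !mxE.
have -> : (if i is i'.+1 then (inclmx n i' l)^T *m inclmx n i' i else 0) a b
    = (if i is i'.+1 then ('C(#|val (enum_val a) :&: val (enum_val b)|, i'))%:R else 0).
  by case: i {il lin} b => [|i'] b; [rewrite mxE | rewrite inclmx_trmul].
set R := val (enum_val a); set I := val (enum_val b).
have Rl : #|R| = l by exact: card_msub_enum.
have Ii : #|I| = i by exact: card_msub_enum.
under eq_bigr => c _ do rewrite !mxE -natrM mulnb -subUset.
rewrite (sum_msub n l.+1 (fun X => (R :|: I \subset X)%:R)) sum_natr_bool.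
have -> : (I \subset R) = (#|R :&: I| == i).
  by rewrite (sameP setIidPr eqP) eqEcard subsetIr Ii /= eqn_leq -{2}Ii subset_leq_card ?subsetIr.
have -> : #|[set x : {set 'I_n} | #|x| == l.+1 & R :|: I \subset x]|
    = if (#|R :|: I| <= l.+1)%N then 'C(n - #|R :|: I|, l.+1 - #|R :|: I|) else 0%N.
  case: leqP => [small | big]; last first.
    rewrite (_ : [set x | _ & _] = set0) ?cards0 //.
    apply/setP => X; rewrite !inE; apply/negP => /andP[/eqP Xl /subset_leq_card].
    by rewrite Xl leqNgt big.
  have := card_between (R :|: I) setT l.+1 (subsetT _) small.
  by rewrite cardsT card_ord => <-; apply: eq_card => X; rewrite !inE subsetT andbC.
move: (cardsU R I) (subset_leq_card (subsetIr R I)); rewrite Rl Ii.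
move: #|R :&: I| #|R :|: I| => s u {a b R I Rl Ii} -> si.
(* The union has l points, l+1 points or more, giving n - l, 1 or 0 supersets of size l+1. *)
have [->|[<-|si2]] : s = i \/ s.+1 = i \/ (s.+1 < i)%N by lia.
- rewrite eqxx mulr1 addnK leqnSn (_ : l.+1 - l = 1)%N ?bin1; last by lia.
  case: i il lin {si} => [|i'] il lin; first by rewrite addr0 subn0.
  by rewrite binSn -natrD; congr (_%:R); lia.
- rewrite ltn_eqF // mulr0 add0r binn (_ : _ - s = l.+1)%N ?leqnn ?subnn ?bin0 //; lia.
- rewrite ltn_eqF ?mulr0 ?add0r; last by lia.
  case: leqP => [|_]; first by lia.
  by case: i si2 {il lin si} => // i' si2; rewrite bin_small.
Qed.

(** * Intersection matrices and their spectra *)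

Definition intermx (n : nat) (g : nat -> C) (k l : nat) :
    'M[C]_(#|{: msub n k}|, #|{: msub n l}|) :=
  \matrix_(a < #|{: msub n k}|, b < #|{: msub n l}|) g #|val (enum_val a) :&: val (enum_val b)|.

Lemma intermx_newton (n : nat) (g : nat -> C) (k l : nat) :
  intermx n g k l = \sum_(i < k.+1) newton g i *: ((inclmx n i k)^T *m inclmx n i l).
Proof.
apply/matrixP => a b; rewrite summxE mxE (newton_forward g k) => [|]; last first.
  by rewrite -[X in (_ <= X)%N](card_msub_enum n k a) subset_leq_card ?subsetIl.
by apply: eq_bigr => i _; rewrite mxE inclmx_trmul.
Qed.

(** By Newton's formula these combinations include every matrix on l-subsets that depends only on
    intersection sizes: they form the Bose-Mesner algebra of the Johnson scheme. *)
Definition johnson (n l : nat) (c : nat -> C) : 'M[C]_#|{: msub n l}| :=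
  \sum_(i < l.+1) c i *: ((inclmx n i l)^T *m inclmx n i l).

(* The coefficients, one level down, of [c_(l+1) + V Z] where the level [l+1]
   matrix is [c_(l+1) + Z V]. *)
Definition descend (n l : nat) (c : nat -> C) (i : nat) : C :=
  c i.+1 + c i * ((n - l - i)%:R / (l.+1 - i)%:R).

(** For k <= l the descent stops at level k and returns the top coefficient there. For k > l it runs
    down to level 0 and the value is only a default. *)
Fixpoint johnson_eig (n l : nat) (c : nat -> C) (k : nat) : C :=
  if l is l'.+1 then
    if k == l then c k else johnson_eig n l' (descend n l' c) k
  else c k.

(** This is the factor Z of [Z V]: since [W_(i,l) V = (l+1-i) W_(i,l+1)], dividing by l+1-i restores
    the coefficient c_i. *)
Definition johnson_cofactor (n l : nat) (c : nat -> C) :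
    'M[C]_(#|{: msub n l.+1}|, #|{: msub n l}|) :=
  \sum_(i < l.+1) (c i / (l.+1 - i)%:R) *: ((inclmx n i l.+1)^T *m inclmx n i l).

Lemma johnson_split (n l : nat) (c : nat -> C) :
  johnson n l.+1 c = (c l.+1)%:M + johnson_cofactor n l c *m inclmx n l l.+1.
Proof.
rewrite /johnson big_ord_recr /= inclmx_id trmx1 mulmx1 scalemx1 addrC.
congr (_ + _); rewrite mulmx_suml; apply: eq_bigr => i _.
have il : (i <= l)%N by rewrite -ltnS.
rewrite -scalemxAl -mulmxA inclmx_mul // -scalemxAr scalerA (subSn il) binSn.
by rewrite -(subSn il) divfK // natrC_eq0; lia.
Qed.

(** Moving V past [W_(i,l+1)^T] leaves a term at index i and one at index i-1. In the latter
    [W_(i-1,i) W_(i,l) = (l+1-i) W_(i-1,l)] cancels the denominator, so c_i is passed down by one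
    index. *)
Lemma johnson_descend (n l : nat) (c : nat -> C) : (l.*2 <= n)%N ->
  (c l.+1)%:M + inclmx n l l.+1 *m johnson_cofactor n l c
    = johnson n l (descend n l c).
Proof.
move=> ln; rewrite mulmx_sumr.
pose G i := (inclmx n i l)^T *m inclmx n i l.
have E (i : 'I_l.+1) : inclmx n l l.+1 *m
      ((c i / (l.+1 - i)%:R) *: ((inclmx n i l.+1)^T *m inclmx n i l))
    = (c i * ((n - l - i)%:R / (l.+1 - i)%:R)) *: G i
      + (if val i is i'.+1 then c i *: G i' else 0).
  have il : (i <= l)%N by rewrite -ltnS.
  rewrite -scalemxAr mulmxA inclmx_up_down //; last by lia.
  rewrite mulmxDl scalerDr -scalemxAl scalerA -mulrA [_^-1 * _]mulrC; congr (_ + _).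
  case: i il => -[|i] //= _ il; first by rewrite mul0mx scaler0.
  rewrite -mulmxA inclmx_mul ?leqnSn // -scalemxAr scalerA.
  rewrite (_ : i.+1 - i = 1)%N ?bin1 ?subSS; last by lia.
  by rewrite divfK // natrC_eq0; lia.
rewrite (eq_bigr _ (fun i _ => E i)) big_split addrCA /johnson.
under [RHS]eq_bigr => i _ do rewrite scalerDl.
rewrite big_split [RHS]addrC /=; congr (_ + _).
(* The shifted sum has nothing at i = 0; its missing last term c_(l+1) is the scalar matrix, as
   [W_(l,l)] is the identity. *)
rewrite big_ord_recl /= add0r big_ord_recr /= inclmx_id trmx1 mulmx1 scalemx1 [LHS]addrC.
by congr (_ + _); apply: eq_bigr => i _.
Qed.

Lemma johnson_tr (n l : nat) (c : nat -> C) : (johnson n l c)^T = johnson n l c.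
Proof.
rewrite /johnson linear_sum; apply: eq_bigr => i _.
by rewrite linearZ /= trmx_mul trmxK.
Qed.

(** The transpose of V (c + Z V) = (c + V Z) V, both level matrices being symmetric. *)
Lemma johnson_intertwine (n l : nat) (c : nat -> C) : (l.*2 <= n)%N ->
  johnson n l.+1 c *m (inclmx n l l.+1)^T
    = (inclmx n l l.+1)^T *m johnson n l (descend n l c).
Proof.
move=> ln; apply: trmx_inj; rewrite !trmx_mul trmxK !johnson_tr.
rewrite johnson_split -johnson_descend // mulmxDr mulmxDl mulmxA.
by rewrite mul_mx_scalar mul_scalar_mx.
Qed.

(** At level k only the term i = k survives on u, with eigenvalue c_k. Each step up carries the
    eigenvector along [V^T], because [W_(k,l+1)^T] is a nonzero multiple of [V^T W_(k,l)^T]. *)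
Lemma johnson_eigenvector (n l k : nat) (c : nat -> C) (u : 'cV[C]_#|{: msub n k}|) :
  (k <= l)%N -> (l.*2 <= n)%N ->
  (forall i, (i < k)%N -> inclmx n i k *m u = 0) ->
  johnson n l c *m ((inclmx n k l)^T *m u)
    = johnson_eig n l c k *: ((inclmx n k l)^T *m u).
Proof.
move=> + + u0.
have top l' c' : k = l' -> johnson n l' c' *m ((inclmx n k l')^T *m u)
    = c' k *: ((inclmx n k l')^T *m u).
  move=> {l'}<-; rewrite /johnson inclmx_id trmx1 mul1mx big_ord_recr /= mulmxDl mulmx_suml.
  rewrite big1 ?add0r => [|i _]; last by rewrite -scalemxAl -mulmxA u0 // mulmx0 scaler0.
  by rewrite inclmx_id trmx1 mulmx1 -scalemxAl mul1mx.
elim: l c => [|l IHl] c; first by rewrite leqn0 => /eqP k0 _; rewrite top.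
rewrite leq_eqVlt /=; case: (eqVneq k l.+1) => [kl _ _|nk /= kl ln]; first by rewrite top.
have nz : (l.+1 - k)%:R != 0 :> C by rewrite natrC_eq0; lia.
have kl' : (k <= l)%N by [].
have -> : (inclmx n k l.+1)^T =
    (l.+1 - k)%:R^-1 *: ((inclmx n l l.+1)^T *m (inclmx n k l)^T).
  rewrite -trmx_mul inclmx_mul // (subSn kl') binSn -(subSn kl') linearZ /=.
  by rewrite scalerA mulVf // scale1r.
rewrite -!scalemxAl -!scalemxAr scalerA mulrC -scalerA; congr (_ *: _).
rewrite -!mulmxA [LHS]mulmxA johnson_intertwine; last by lia.
by rewrite -mulmxA IHl -?scalemxAr //; lia.
Qed.

Lemma leq_bin_half (n l : nat) : (l.+1.*2 <= n)%N -> ('C(n, l) <= 'C(n, l.+1))%N.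
Proof.
move=> ln; have E := mul_bin_left n l.
have : ('C(n, l) * l.+1 <= 'C(n, l.+1) * l.+1)%N.
  by rewrite [X in (_ <= X)%N]mulnC E mulnC leq_mul2r; lia.
by rewrite leq_mul2r.
Qed.

Lemma char_poly_johnson (n l : nat) (c : nat -> C) : (l.*2 <= n)%N ->
  char_poly (johnson n l c)
    = \prod_(k < l.+1) ('X - (johnson_eig n l c k)%:P)
        ^+ ('C(n, k) - (if val k is k'.+1 then 'C(n, k') else 0)).
Proof.
elim: l c => [|l IHl] c ln.
  rewrite big_ord1 /= subn0 /johnson big_ord1 /= inclmx_id trmx1 mulmx1 scalemx1.
  rewrite /char_poly /char_poly_mx map_scalar_mx -raddfB det_scalar /=.
  by rewrite card_msub.
rewrite johnson_split char_poly_scalar_add_mulmxC; last first.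
  by rewrite !card_msub leq_bin_half.
rewrite johnson_descend ?IHl; [|lia|lia].
rewrite [RHS]big_ord_recr /= eqxx mulrC !card_msub; congr (_ * _).
by apply: eq_bigr => k _; rewrite ltn_eqF.
Qed.

(** Descending preserves the vanishing of the coefficients above j. *)
Lemma johnson_eig_above (n l j k : nat) (c : nat -> C) :
  (forall i, (j < i)%N -> c i = 0) -> (j < k)%N -> johnson_eig n l c k = 0.
Proof.
move=> + jk; elim: l c => [|l IHl] c c0 /=; first exact: c0.
case: ifP => _; first exact: c0.
by apply: IHl => i ji; rewrite /descend !c0 ?mul0r ?addr0 // ltnW.
Qed.

(** As c_(j+1) = 0, each descent multiplies c_j by (n-l-j)/(l+1-j), which is nonzero below the
    middle level. *)
Lemma johnson_eig_top_neq0 (n l j : nat) (c : nat -> C) : (l.*2 <= n)%N -> (j <= l)%N ->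
  (forall i, (j < i)%N -> c i = 0) -> c j != 0 -> johnson_eig n l c j != 0.
Proof.
elim: l c => [|l IHl] c ln jl c0 cj //=.
case: (eqVneq j l.+1) => [//|nj]; apply: IHl; [lia|lia| |].
  by move=> i ji; rewrite /descend !c0 ?mul0r ?addr0 // ltnW.
rewrite /descend c0 // add0r mulf_neq0 // mulf_neq0 ?invr_eq0 ?natrC_eq0 //; lia.
Qed.

(** * The polytabloid of the tableau T_k *)

Lemma card_Omega (n k : nat) : (k <= n)%N -> #|Omega n k| = k.
Proof.
move=> kn; rewrite -sum1_card /Omega; under eq_bigl => i do rewrite inE.
by rewrite -(big_geq_mkord (n - k) n xpredT (fun=> 1%N)) sum_nat_const_nat subKn // muln1.
Qed.

Lemma colgrp_colT {n k : nat} {q : {perm 'I_n}} : q \in colgrp n k ->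
  forall i, colT n k (q i) = colT n k i.
Proof. by rewrite inE => /forallP h i; exact: (eqP (h i)). Qed.

Lemma colgrpM (n k : nat) (q t : {perm 'I_n}) : t \in colgrp n k ->
  ((q * t)%g \in colgrp n k) = (q \in colgrp n k).
Proof.
move=> /colgrp_colT tc; rewrite !inE; apply: eq_forallb => i.
by rewrite permM tc.
Qed.

(** The polytabloid of T_k: a tabloid of shape (n-k,k) is determined by its second row, which for
    T_k is [Omega n k]. *)
Definition specht (n k : nat) : 'cV[C]_#|{: msub n k}| :=
  \col_(a < #|{: msub n k}|) \sum_(q in colgrp n k)
     (-1) ^+ odd_perm q * ((q @: Omega n k) == val (enum_val a))%:R.

Lemma specht_pairing (n k : nat) (h : {set 'I_n} -> C) : (k <= n)%N ->
  \sum_(a < #|{: msub n k}|) h (val (enum_val a)) * specht n k a 0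
    = \sum_(q in colgrp n k) (-1) ^+ odd_perm q * h (q @: Omega n k).
Proof.
move=> kn; under eq_bigr => a _ do rewrite mxE mulr_sumr.
rewrite exchange_big; apply: eq_bigr => q _ /=.
rewrite (sum_msub n k (fun A => h A * ((-1) ^+ odd_perm q * ((q @: Omega n k) == A)%:R))).
have cq : #|q @: Omega n k| == k by rewrite card_imset ?card_Omega //; apply: perm_inj.
rewrite (bigD1 (q @: Omega n k)) //= eqxx mulr1 mulrC big1 ?addr0 // => A /andP[_].
by rewrite eq_sym => /negbTE->; rewrite !mulr0.
Qed.

(* Fewer than k points miss one of the k columns of height two entirely, and
   swapping the two entries of that column reverses signs. *)
Lemma inclmx_specht (n i k : nat) : (k.*2 <= n)%N -> (i < k)%N ->
  inclmx n i k *m specht n k = 0.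
Proof.
move=> kn ik; apply/matrixP => a z; rewrite ord1 !mxE; set I := val (enum_val a).
have Ii : #|I| = i by exact: card_msub_enum.
have -> : \sum_j inclmx n i k a j * specht n k j 0
    = \sum_(q in colgrp n k) (-1) ^+ odd_perm q * (I \subset q @: Omega n k)%:R.
  rewrite -(specht_pairing n k (fun A => (I \subset A)%:R)); last by lia.
  by apply: eq_bigr => b _; congr (_ * _); rewrite mxE.
have [x xk xI] : exists2 x : 'I_n, (x < k)%N & forall y, y \in I -> colT n k y <> x.
  (* The default of [insubd] is never reached, as column numbers are below n. *)
  pose f y : 'I_n := insubd y (colT n k y).
  have fE y : val (f y) = colT n k y.
    by rewrite val_insubd /colT; case: ifP (ltn_ord y) => //; case: ifP => //; lia.
  have : ~~ ([set x : 'I_n | (x < k)%N] \subset f @: I).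
    apply/negP => /subset_leq_card; apply/negP; rewrite -ltnNge.
    apply: leq_ltn_trans (leq_imset_card _ _) _; rewrite Ii.
    rewrite -sum1_card; under eq_bigl => y do rewrite inE.
    have kn' : (k <= n)%N by lia.
    by rewrite -(big_ord_widen n (fun=> 1%N)) // sum1_card card_ord.
  case/subsetPn=> x; rewrite inE => xk xI; exists x => // y yI E.
  by case/negP: xI; apply/imsetP; exists y => //; apply/val_inj; rewrite fE.
have yn : (n - k + x < n)%N by lia.
pose y := Ordinal yn.
have cx : colT n k x = x by rewrite /colT ifT //; lia.
have cy : colT n k y = x by rewrite /colT /= ifF; lia.
have tc : tperm x y \in colgrp n k.
  by rewrite inE; apply/forallP => j; case: tpermP => // ->; rewrite cx cy.
have tO (q : {perm 'I_n}) j :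
    (j \in (q * tperm x y)%g @: Omega n k) = (tperm x y j \in q @: Omega n k).
  rewrite -{1}(tpermK x y j).
  have -> : (q * tperm x y)%g @: Omega n k = tperm x y @: (q @: Omega n k).
    by rewrite -imset_comp; apply: eq_imset => z'; rewrite /= permM.
  by rewrite mem_imset //; apply: perm_inj.
have tfix j : j \in I -> tperm x y j = j.
  by move/xI => cj; rewrite tpermD //; apply/eqP => E; apply: cj; rewrite -E.
have tI (q : {perm 'I_n}) : (I \subset (q * tperm x y)%g @: Omega n k) = (I \subset q @: Omega n k).
  apply/subsetP/subsetP => h j jI; first by rewrite -(tfix j) // -tO h.
  by rewrite tO tfix // h.
set S := \sum_(q in _) _.
have : S = - S.
  rewrite {1}/S (reindex_inj (mulIg (tperm x y))) -sumrN.
  apply: eq_big => [q|q _]; first by rewrite colgrpM.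
  rewrite tI odd_permM odd_tperm (_ : x != y) ?addbT; last by rewrite -val_eqE /=; lia.
  by case: (odd_perm q); rewrite /= ?expr1 ?expr0 ?mulN1r ?opprK ?mul1r.
move/eqP; rewrite -addr_eq0 -mulr2n -mulr_natr mulf_eq0 natrC_eq0 orbF.
by move/eqP.
Qed.

(** * The image of the Young symmetrizer *)

(** Swap a point of A outside B with a point of B outside A, and induct on the size of A minus B.
    Only the symmetric difference is moved, which later keeps the rows of T_k intact. *)
Lemma perm_moves_set {T : finType} (A B : {set T}) : #|A| = #|B| ->
  exists2 p : {perm T}, p @: A = B & forall x, (x \in A) = (x \in B) -> p x = x.
Proof.
have [d] := ubnP #|A :\: B|; elim: d A => // d IHd A dA cAB.
have [AB|] := boolP (A \subset B).
  exists 1%g; last by move=> x _; rewrite perm1.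
  have -> : A = B by apply/eqP; rewrite eqEcard AB cAB leqnn.
  by rewrite -[RHS](imset_id B); apply: eq_imset => x; rewrite perm1.
case/subsetPn=> a aA aB.
have : ~~ (B \subset A).
  by apply/negP => BA; case/negP: aB; have -> // : B = A; apply/eqP; rewrite eqEcard BA cAB leqnn.
case/subsetPn=> b bB bA.
have ab : a != b by apply: contraNneq aB => ->.
have memA x : (x \in tperm a b @: A) = (tperm a b x \in A).
  by rewrite -{1}(tpermK a b x) mem_imset //; apply: perm_inj.
have [||p pA pfix] := IHd (tperm a b @: A); last 1 first.
- exists (tperm a b * p)%g.
    by rewrite -pA -imset_comp; apply: eq_imset => x; rewrite /= permM.
  move=> x xAB; rewrite permM.
  have xa : a != x by apply: contraNneq aB => E; rewrite E -xAB -E.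
  have xb : b != x by apply: contraNneq bA => E; rewrite E xAB -E.
  by rewrite tpermD // pfix // memA tpermD.
- apply: (leq_trans _ (dA : (_ <= d)%N)); apply: proper_card; apply/properP; split.
    apply/subsetP => x; rewrite !inE memA => /andP[xB]; rewrite xB.
    by case: tpermP => // E; [rewrite E (negbTE bA) | rewrite E bB in xB].
  by exists a; rewrite !inE ?aA ?aB // memA tpermL (negbTE bA) andbF.
- by rewrite card_imset //; apply: perm_inj.
Qed.

Lemma rowgrp_rowT {n k : nat} {q : {perm 'I_n}} : q \in rowgrp n k ->
  forall i, rowT n k (q i) = rowT n k i.
Proof. by rewrite inE => /forallP h i; exact: (eqP (h i)). Qed.

Lemma rowgrpM (n k : nat) (q t : {perm 'I_n}) : t \in rowgrp n k ->
  ((q * t)%g \in rowgrp n k) = (q \in rowgrp n k).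
Proof.
move=> /rowgrp_rowT tc; rewrite !inE; apply: eq_forallb => i.
by rewrite permM tc.
Qed.

(** The integer relating [pi (c_k)] to [W_(k,m)^T u]; for k <= m <= n it is k! (m-k)! (n-m)!. *)
Definition row_stab (n m k : nat) : nat :=
  #|[set p in rowgrp n k | p @: Omega n m == Omega n m]|.

Lemma row_stab_neq0 (n m k : nat) : row_stab n m k != 0%N.
Proof.
rewrite -lt0n card_gt0; apply/set0Pn; exists 1%g; rewrite !inE.
apply/andP; split; first by apply/forallP => i; rewrite perm1.
by rewrite -[X in _ == X]imset_id; apply/eqP/eq_imset => x; rewrite perm1.
Qed.

(** Row permutations preserve [Omega n k], so every image of [Omega n m] contains it. Conversely
    each m-set A containing it is reached by some [p0], and the permutations reaching A form a coset
    of the stabilizer. *)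
Lemma row_orbit_count (n m k : nat) (A : {set 'I_n}) : (k <= m)%N -> (m <= n)%N ->
  #|A| = m ->
  #|[set p in rowgrp n k | p @: Omega n m == A]|
    = if Omega n k \subset A then row_stab n m k else 0%N.
Proof.
move=> km mn Am.
have kO : Omega n k \subset Omega n m by apply/subsetP => i; rewrite !inE; lia.
have stabO p : p \in rowgrp n k -> p @: Omega n k = Omega n k.
  move/rowgrp_rowT => pr; apply/eqP; rewrite eqEcard card_imset ?leqnn ?andbT; last exact: perm_inj.
  by apply/subsetP => _ /imsetP[x + ->]; rewrite !inE; have := pr x; rewrite /rowT => ->.
case: ifPn => [kA | nkA]; last first.
  apply: eq_card0 => p; rewrite inE; apply/negP => /andP[/stabO pr /eqP E].
  by case/negP: nkA; rewrite -E -pr imsetS.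
have [|p0 p0A p0f] := perm_moves_set (Omega n m) A; first by rewrite card_Omega.
have p0r : p0 \in rowgrp n k.
  have fixk x : rowT n k x -> p0 x = x.
    move=> xk; have xO : x \in Omega n k by rewrite inE.
    by apply: p0f; rewrite (subsetP kO) // (subsetP kA).
  rewrite inE; apply/forallP => x.
  have [xk|nxk] := boolP (rowT n k x); first by rewrite fixk // xk.
  rewrite eqbF_neg; apply: contraNN nxk => h.
  by have /perm_inj <- := fixk _ h.
have p0M p : (p * p0)%g @: Omega n m = p0 @: (p @: Omega n m).
  by rewrite -imset_comp; apply: eq_imset => x; rewrite /= permM.
rewrite /row_stab -[RHS](card_imset _ (mulIg p0)); apply: eq_card => p.
apply/idP/imsetP => [|[r]]; last first.
  rewrite [r \in _]in_set => /andP[rr /eqP rO] ->.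
  by rewrite [_ \in _]in_set rowgrpM // rr p0M rO p0A eqxx.
rewrite [p \in _]in_set => /andP[pr pA]; exists (p * p0^-1)%g; last by rewrite mulgKV.
rewrite [_ \in _]in_set -(rowgrpM n k _ _ p0r) mulgKV pr /=.
by rewrite -(inj_eq (imset_inj (@perm_inj _ p0))) -p0M mulgKV p0A.
Qed.

(** The coefficient at A sums, over column permutations q, the sign of q times the number of row
    permutations sending [Omega n m] to q^-1(A). That number is [row_stab] or 0 according to whether
    q maps [Omega n k] into A. *)
Lemma youngc_specht (n m k : nat) : (k <= m)%N -> (m <= n)%N ->
  colvec n m (piM n m (youngc n k))
    = (row_stab n m k)%:R *: ((inclmx n k m)^T *m specht n k).
Proof.
move=> km mn; apply/matrixP => a z; rewrite ord1 !mxE ffunE.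
set A := val (enum_val a); have Am : #|A| = m by exact: card_msub_enum.
have -> : \sum_j (inclmx n k m)^T a j * specht n k j 0
    = \sum_(q in colgrp n k) (-1) ^+ odd_perm q * (q @: Omega n k \subset A)%:R.
  rewrite -(specht_pairing n k (fun X => (X \subset A)%:R)); last by lia.
  by apply: eq_bigr => b _; congr (_ * _); rewrite !mxE.
transitivity (\sum_(q : {perm 'I_n}) \sum_(p : {perm 'I_n})
    colsym n k q * (rowsym n k p * (((p * q)%g @: Omega n m) == A)%:R)).
  under eq_bigr => g _ do rewrite /youngc ffunE mulr_suml.
  rewrite exchange_big; apply: eq_bigr => q _ /=.
  rewrite [RHS](partition_big (fun p => (p * q)%g) xpredT) //=.
  apply: eq_bigr => g _; rewrite mulr_suml.
  by apply: eq_bigr => p /eqP->; rewrite mulrA.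
rewrite mulr_sumr [RHS]big_mkcond; apply: eq_bigr => q _.
rewrite -mulr_sumr ffunE; case: ifP => _; last by rewrite mul0r.
rewrite mulrCA; congr (_ * _).
have cA : #|(q^-1)%g @: A| = m by rewrite card_imset //; apply: perm_inj.
have qK (X : {set 'I_n}) : q @: ((q^-1)%g @: X) = X.
  by rewrite -imset_comp -[RHS]imset_id; apply: eq_imset => x /=; rewrite permKV.
have Kq (X : {set 'I_n}) : (q^-1)%g @: (q @: X) = X.
  by rewrite -imset_comp -[RHS]imset_id; apply: eq_imset => x /=; rewrite permK.
have -> : (q @: Omega n k \subset A) = (Omega n k \subset (q^-1)%g @: A).
  by apply/idP/idP => h; [rewrite -(Kq (Omega n k)) | rewrite -(qK A)]; apply: imsetS.
transitivity (#|[set p in rowgrp n k | p @: Omega n m == (q^-1)%g @: A]|%:R : C).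
  rewrite -sum_natr_bool [RHS]big_mkcond; apply: eq_bigr => p _.
  rewrite ffunE; case: (p \in rowgrp n k); last by rewrite mul0r.
  rewrite mul1r; congr (_%:R).
  have -> : (p * q)%g @: Omega n m = q @: (p @: Omega n m).
    by rewrite -imset_comp; apply: eq_imset => x; rewrite /= permM.
  by congr (nat_of_bool _); apply/eqP/eqP => [<-|->]; rewrite ?Kq ?qK.
by rewrite row_orbit_count //; case: ifP; rewrite ?mulr1 ?mulr0.
Qed.

(** The coefficient at [Omega n m] is 1, since only q = 1 contributes. *)
Lemma specht_lift_neq0 (n m k : nat) : (k <= m)%N -> (m.*2 <= n)%N ->
  (inclmx n k m)^T *m specht n k != 0.
Proof.
move=> km mn.
have cO : #|Omega n m| == m by rewrite card_Omega //; lia.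
pose a := enum_rank (exist _ (Omega n m) cO : msub n m).
apply/negP => /eqP /matrixP /(_ a 0); rewrite !mxE.
have aE : val (enum_val a) = Omega n m by rewrite enum_rankK.
have -> : \sum_j (inclmx n k m)^T a j * specht n k j 0
    = \sum_(q in colgrp n k) (-1) ^+ odd_perm q * (q @: Omega n k \subset Omega n m)%:R.
  rewrite -(specht_pairing n k (fun X => (X \subset Omega n m)%:R)); last by lia.
  by apply: eq_bigr => b _; congr (_ * _); rewrite !mxE aE.
have kO : Omega n k \subset Omega n m by apply/subsetP => i; rewrite !inE; lia.
have c1 : 1%g \in colgrp n k by rewrite inE; apply/forallP => i; rewrite perm1.
have i1 : (1%g : {perm 'I_n}) @: Omega n k = Omega n k.
  by rewrite -[RHS]imset_id; apply: eq_imset => x; rewrite perm1.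
rewrite (bigD1 1%g) //= odd_perm1 expr0 mul1r i1 kO big1 ?addr0.
  by move/eqP; rewrite oner_eq0.
move=> q /andP[/colgrp_colT qc q1].
case: (boolP (_ \subset _)) => [/subsetP h|]; last by rewrite mulr0.
case/negP: q1; apply/eqP/permP => x; rewrite perm1.
(* The column partner of y in the second row is y - (n-k) < k <= n - m, hence outside
   [Omega n m]. *)
have fixk (y : 'I_n) : (n - k <= y)%N -> q y = y.
  move=> yk; have /h : q y \in q @: Omega n k by rewrite imset_f // inE.
  rewrite inE => qm; apply/val_inj => /=.
  have := qc y; have := ltn_ord y; have := ltn_ord (q y); rewrite /colT.
  by case: ifP => h1; case: ifP => h2; lia.
(* A first-row x cannot go to the second row: q already fixes q x there, so injectivity would give q
   x = x. *)
have [xk|xk] := leqP (n - k) x; first exact: fixk.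
have := qc x; rewrite /colT xk; case: ifPn => [_ /val_inj //|].
rewrite -leqNgt => /fixk /perm_inj -> //.
Qed.

(** * The eigenvalues lambda_k *)

(** The m-sets X containing K are grouped by the number p of points of X meet S outside K. The
    resulting function of j is the inner sum of lambda_k. *)
Lemma inclmx_mul_intermx (n m k : nat) (g : nat -> C) : (k <= m)%N -> (m.*2 <= n)%N ->
  inclmx n k m *m intermx n g m m
    = intermx n (fun j => \sum_(p < (m - k).+1) ('C(m - j, p))%:R
        * ('C(n - m - k + j, m - k - p))%:R * g (j + p)%N) k m.
Proof.
move=> km mn; apply/matrixP => a b; rewrite !mxE.
set K := val (enum_val a); set S := val (enum_val b).
have Kk : #|K| = k by exact: card_msub_enum.
have Sm : #|S| = m by exact: card_msub_enum.
under eq_bigr => c _ do rewrite !mxE.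
rewrite (sum_msub n m (fun X => (K \subset X)%:R * g #|X :&: S|)).
transitivity (\sum_(X : {set 'I_n} | #|X| == m) \sum_(p < (m - k).+1)
    ((K \subset X) && (#|X :&: S| == #|K :&: S| + p)%N)%:R * g (#|K :&: S| + p)%N).
  apply: eq_bigr => X /eqP Xm; case KX: (K \subset X); last first.
    by rewrite mul0r big1 // => p _; rewrite mul0r.
  have h1 : (#|K :&: S| <= #|X :&: S|)%N by rewrite subset_leq_card // setSI.
  have h2 : (#|X :&: S| - #|K :&: S| < (m - k).+1)%N.
    rewrite -cardsDS ?setSI // ltnS -Xm -Kk -cardsDS // subset_leq_card //.
    by apply/subsetP => x; rewrite !inE; case: (x \in S); rewrite ?andbF ?andbT.
  rewrite (bigD1 (Ordinal h2)) //= subnKC // eqxx big1 ?addr0 // => p.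
  by rewrite -val_eqE /= => np; rewrite (_ : _ == _ = false) ?mul0r //; apply/eqP; lia.
rewrite exchange_big; apply: eq_bigr => p _ /=.
rewrite -mulr_suml sum_natr_bool -natrM; congr (_%:R * _).
have := card_superset_meet K S p (m - k - p).
have -> : (#|K| + p + (m - k - p) = m)%N by have := ltn_ord p; lia.
have -> : #|S :\: K| = (m - #|K :&: S|)%N by rewrite cardsD Sm setIC.
have -> : #|~: (S :|: K)| = (n - m - k + #|K :&: S|)%N.
  have := cardsC (S :|: K); have := cardsUI S K; rewrite card_ord Sm Kk setIC.
  have := subset_leq_card (subsetIl K S); lia.
by move=> <-; apply: eq_card => X; rewrite !inE andbA [_ && (K \subset X)]andbC -andbA.
Qed.

Lemma Bmat_eigenvector (n m k : nat) (b : 'I_m.+1 -> C) : (k <= m)%N -> (m.*2 <= n)%N ->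
  Bmat n m b *m ((inclmx n k m)^T *m specht n k)
    = lambdak n m k b *: ((inclmx n k m)^T *m specht n k).
Proof.
move=> km mn; pose g s := b (inord s).
(* Symmetry of B turns [B W_(k,m)^T] into the transpose of [W_(k,m) B]. *)
have -> : Bmat n m b = (intermx n g m m)^T.
  by apply/matrixP => i j; rewrite !mxE setIC.
rewrite mulmxA -trmx_mul inclmx_mul_intermx // intermx_newton linear_sum /=.
rewrite mulmx_suml big_ord_recr /= big1 => [|i _].
  rewrite add0r linearZ /= -scalemxAl trmx_mul trmxK inclmx_id mulmx1; congr (_ *: _).
  rewrite /newton /lambdak; apply: eq_bigr => j _; rewrite mulr_sumr.
  by apply: eq_bigr => p _; rewrite !mulrA.
rewrite linearZ /= -scalemxAl trmx_mul trmxK -mulmxA inclmx_specht ?mulmx0 ?scaler0 //; lia.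
Qed.

(** Both are eigenvalues of one matrix on the same nonzero vector. *)
Lemma lambdak_johnson_eig (n m k : nat) (b : 'I_m.+1 -> C) (c : nat -> C) :
  (k <= m)%N -> (m.*2 <= n)%N -> Bmat n m b = johnson n m c ->
  lambdak n m k b = johnson_eig n m c k.
Proof.
move=> km mn E; apply/eqP; rewrite -subr_eq0.
have kn : (k.*2 <= n)%N by lia.
have := johnson_eigenvector n m k c (specht n k) km mn (fun i => inclmx_specht n i k kn).
rewrite -E Bmat_eigenvector // => /eqP; rewrite -subr_eq0 -scalerBl scalemx_eq0.
by rewrite (negbTE (specht_lift_neq0 n m k km mn)) orbF.
Qed.

Lemma Bmat_johnson (n m : nat) (b : 'I_m.+1 -> C) :
  Bmat n m b = johnson n m (newton (fun s => b (inord s))).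
Proof. by rewrite -[RHS]intermx_newton; apply/matrixP => i j; rewrite !mxE. Qed.

(** With b_s = binom(s,j) the matrix is [W_(j,m)^T W_(j,m)]: its only coefficient is at j, so
    lambda_k = 0 for k > j while lambda_j is nonzero. *)
Lemma lambdak_separation (n m j k : nat) : (j < k)%N -> (k <= m)%N -> (m.*2 <= n)%N ->
  exists b : 'I_m.+1 -> C, lambdak n m j b != lambdak n m k b.
Proof.
move=> jk km mn; pose c i : C := (i == j)%:R.
have jm : (j < m.+1)%N by lia.
have E : Bmat n m (fun s => ('C(s, j))%:R) = johnson n m c.
  rewrite /johnson (bigD1 (Ordinal jm)) //= /c eqxx scale1r big1 ?addr0 => [|i].
    apply/matrixP => x y; rewrite mxE inclmx_trmul inordK // ltnS.
    by rewrite -[X in (_ <= X)%N](card_msub_enum n m x) subset_leq_card ?subsetIl.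
  by rewrite -val_eqE /= => /negbTE->; rewrite scale0r.
have c0 i : (j < i)%N -> c i = 0 by move=> ji; rewrite /c gtn_eqF.
exists (fun s => ('C(s, j))%:R).
rewrite (lambdak_johnson_eig _ _ j _ c) // (lambdak_johnson_eig _ _ k _ c) //.
rewrite (johnson_eig_above n m j k) // johnson_eig_top_neq0 //.
by rewrite /c eqxx oner_eq0.
Qed.

(** * Multiplicities for generic b *)

(** Multiplied by k! (n-k+1)!, the two binomials become n! (n-k+1) and n! k, so the division in
    [fdim] is exact. *)
Lemma fdim_bin (n k : nat) : (k.*2 <= n)%N ->
  fdim n k = ('C(n, k) - (if k is k'.+1 then 'C(n, k') else 0))%N.
Proof.
rewrite /fdim => kn.
suff E : (n`! * (n - 2 * k + 1) = ('C(n, k) - (if k is k'.+1 then 'C(n, k') else 0))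
    * (k`! * (n - k + 1)`!))%N by rewrite E mulnK // muln_gt0 !fact_gt0.
case: k kn => [|k] kn.
  by rewrite bin0 fact0 !subn0 !mul1n !addn1 factS mulnC.
have nk : (n - k.+1 + 1 = n - k)%N by lia.
have E1 : ('C(n, k.+1) * (k.+1`! * (n - k)`!) = n`! * (n - k))%N.
  have h : (n - k = (n - k.+1).+1)%N by lia.
  have kn' : (k.+1 <= n)%N by lia.
  by rewrite h factS -(bin_fact kn') !mulnA mulnAC.
have E2 : ('C(n, k) * (k.+1`! * (n - k)`!) = n`! * k.+1)%N.
  have kn' : (k <= n)%N by lia.
  by rewrite factS -(bin_fact kn') -[(_ * k`! * _)%N]mulnA mulnCA [RHS]mulnC.
by rewrite nk mulnBl E1 E2 -mulnBr; congr (_ * _)%N; lia.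
Qed.

(** Treating b_0, ..., b_m as indeterminates lets genericity be the nonvanishing of a polynomial. *)
Definition lambda_mpoly (n m k : nat) : {mpoly C[m.+1]} :=
  \sum_(j < k.+1) \sum_(p < (m - k).+1)
     ((-1) ^+ (k - j) * ('C(k, j))%:R * ('C(m - j, p))%:R
       * ('C(n - m - k + j, m - k - p))%:R) *: 'X_(inord (j + p)).

Lemma meval_lambda (n m k : nat) (b : 'I_m.+1 -> C) :
  (lambda_mpoly n m k).@[b] = lambdak n m k b.
Proof.
rewrite raddf_sum; apply: eq_bigr => j _; rewrite raddf_sum; apply: eq_bigr => p _.
by rewrite /= mevalZ mevalXU.
Qed.

Lemma mup_prod_XsubC_exp {F : fieldType} (d : nat) (a : nat -> F) (e : nat -> nat) (k : nat) :
  (k < d)%N -> (forall j, (j < d)%N -> j != k -> a j != a k) ->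
  mup (a k) (\prod_(j < d) ('X - (a j)%:P) ^+ e j) = e k.
Proof.
move=> kd ha; rewrite (bigD1 (Ordinal kd)) //= mupMl ?mup_XsubCX ?eqxx //.
rewrite /root horner_prod; apply/prodf_neq0 => j jk.
by rewrite horner_exp hornerXsubC expf_neq0 // subr_eq0 eq_sym ha.
Qed.

Theorem theorem1 (n m k : nat) :
  (0 < n)%N -> (m <= n./2)%N -> (k <= m)%N ->
  [/\ (forall b : 'I_m.+1 -> C,
         Bmat n m b *m colvec n m (piM n m (youngc n k))
         = lambdak n m k b *: colvec n m (piM n m (youngc n k))),
      colvec n m (piM n m (youngc n k)) != 0
    & exists P : {mpoly C[m.+1]}, P != 0 /\
        forall b : 'I_m.+1 -> C, P.@[b] != 0 ->
          mup (lambdak n m k b) (char_poly (Bmat n m b)) = fdim n k].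
Proof.
move=> _ mn km; have {}mn : (m.*2 <= n)%N by lia.
have E : colvec n m (piM n m (youngc n k))
    = (row_stab n m k)%:R *: ((inclmx n k m)^T *m specht n k).
  by apply: youngc_specht => //; lia.
split=> [b||].
- by rewrite E -scalemxAr Bmat_eigenvector // !scalerA mulrC.
- by rewrite E scaler_eq0 natrC_eq0 (negbTE (row_stab_neq0 n m k)) specht_lift_neq0.
(* Where this product does not vanish, lambda_k differs from every other lambda_j, so its
   multiplicity is the exponent of its own factor. Each factor is a nonzero polynomial because some
   b separates the two eigenvalues. *)
exists (\prod_(j < m.+1 | val j != k) (lambda_mpoly n m j - lambda_mpoly n m k)); split.
  apply/prodf_neq0 => j jk; rewrite subr_eq0; apply/eqP => Ejk.
  have jm : (j <= m)%N by rewrite -ltnS.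
  have [b] : exists b : 'I_m.+1 -> C, lambdak n m j b != lambdak n m k b.
    have [jk'|kj|E'] := ltngtP j k; [exact: lambdak_separation| |by rewrite /= E' eqxx in jk].
    by have [b hb] := lambdak_separation n m k j kj jm mn; exists b; rewrite eq_sym.
  by rewrite -!meval_lambda Ejk eqxx.
move=> b; rewrite rmorph_prod /= => /prodf_neq0 hb.
set c := newton (fun s => b (inord s)).
have lE j : (j <= m)%N -> lambdak n m j b = johnson_eig n m c j.
  by move=> jm; apply: lambdak_johnson_eig => //; apply: Bmat_johnson.
rewrite Bmat_johnson char_poly_johnson // lE //.
rewrite (mup_prod_XsubC_exp m.+1 (johnson_eig n m c)
  (fun i => 'C(n, i) - (if i is i'.+1 then 'C(n, i') else 0))%N) //.
  by rewrite fdim_bin //; lia.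
move=> j jm jk; have := hb (Ordinal jm) jk.
by rewrite rmorphB /= !meval_lambda !lE // subr_eq0.
Qed.
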